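(* There exists a deterministic automaton $\mathcal{D}=(Q,\bar B,\Gamma,q_0,\tau)$ over the alphabet $\bar B=\{-1,0,1\}$ with an output function $\tau:Q\to\bar B$ such that $\Gamma(q_0,0)=q_0$ and $\tau(\Gamma(q_0,(m)_Z\boxminus(n)_Z))=\delta(m-n,n)$ for all integers $m\geq n\geq0$.
   Context: Zeckendorf numeration: let $F_{-2}=0$, $F_{-1}=1$, $F_n=F_{n-1}+F_{n-2}$ for $n\geq 0$. Every $n\in\mathbb{N}$ has a unique expansion $n=\sum_{i=0}^k b_iF_i$ with $b_i\in\{0,1\}$ and no two consecutive digits $1$, up to leading zeros; $(n)_Z=b_k\cdots b_0$ (read from the most significant digit, possibly padded with leading zeros). Define $\phi:\mathbb{N}\to\mathbb{N}$ by $\phi(\sum_i b_iF_i)=\sum_i b_iF_{i+1}$ where $(n)_Z=b_k\cdots b_0$, and $\delta(m,n)=\phi(m+n)-\phi(m)-\phi(n)$ for $m,n\in\mathbb{N}$. For words $u=u_k\cdots u_0$, $v=v_k\cdots v_0$ of integers, padded with leading zeros to the same length, $u\boxminus v=(u_k-v_k)\cdots(u_0-v_0)$. A deterministic automaton with output has a finite state set $Q$, a transition function $\Gamma:Q\times\bar B\to Q$ extended to $Q\times\bar B^*$ by $\Gamma(q,\varepsilon)=q$ and $\Gamma(q,b_1\cdots b_n)=\Gamma(\Gamma(q,b_1\cdots b_{n-1}),b_n)$, an initial state $q_0$ and an output function $\tau$. *)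

(* Defs.v *)
From HB Require Import structures.
From mathcomp Require Import all_boot all_order all_algebra.

Set Implicit Arguments.
Unset Strict Implicit.
Unset Printing Implicit Defensive.

Import Order.TTheory GRing.Theory Num.Theory.

(* fib is the usual Fibonacci sequence; F n is F_n for n >= 0 in the indexing
   F_{-2} = 0, F_{-1} = 1, so F 0 = 1, F 1 = 2, F 2 = 3, F 3 = 5, ... *)
Fixpoint fib (n : nat) : nat :=
  if n is n1.+1 then (if n1 is n2.+1 then fib n1 + fib n2 else 1) else 0.

Definition F (n : nat) : nat := fib n.+2.

(* Words are written most significant digit first: the digit b_i of
   w = b_k ... b_0 is nth _ (rev w) i.  A binary word is a seq bool, its digits
   being read as numbers through the coercion from bool to nat.
   fibval s w = \sum_i b_i F_{i+s}. *)
Definition fibval (s : nat) (w : seq bool) : nat :=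
  \sum_(i < size w) nth false (rev w) i * F (i + s).

(* w is a Zeckendorf expansion of n, possibly with leading zeros. *)
Definition zeckendorf (n : nat) (w : seq bool) : bool :=
  sorted (fun a b => ~~ (a && b)) w && (fibval 0 w == n).

Lemma FSS n : F n.+2 = F n.+1 + F n.
Proof. by []. Qed.

Lemma fibval_cons s b w : fibval s (b :: w) = b * F (size w + s) + fibval s w.
Proof.
rewrite /fibval /= big_ord_recr /= rev_cons nth_rcons size_rev ltnn eqxx addnC.
by congr addn; apply: eq_bigr => i _; rewrite nth_rcons size_rev ltn_ord.
Qed.

Lemma fibval_pad s k w : fibval s (nseq k false ++ w) = fibval s w.
Proof. by elim: k => //= k IHk; rewrite fibval_cons IHk. Qed.

Lemma sorted_pad k w :
  sorted (fun a b : bool => ~~ (a && b)) w ->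
  sorted (fun a b : bool => ~~ (a && b)) (nseq k false ++ w).
Proof. by move=> w_ok; elim: k => //= k; case: (_ ++ _). Qed.

Lemma fibval_lt w :
  sorted (fun a b : bool => ~~ (a && b)) w -> fibval 0 w < F (size w).
Proof.
have [n] := ubnP (size w); elim: n w => // n IHn [|b w] /=.
  by rewrite /fibval big_ord0.
rewrite ltnS => le_wn; rewrite fibval_cons addn0.
have F_le k : F k <= F k.+1 by case: k => // k; rewrite FSS leq_addr.
case: b => /= w_ok.
  case: w w_ok le_wn => [|[] w] //=; first by rewrite /fibval big_ord0.
  move=> w_ok lt_wn.
  rewrite fibval_cons add0n mul1n FSS ltn_add2l; apply: IHn.
    exact: ltnW.
  exact: path_sorted w_ok.
rewrite add0n; apply: leq_trans (F_le _); apply: IHn => //.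
exact: path_sorted w_ok.
Qed.

Lemma zeckendorf_exists n : exists w, zeckendorf n w.
Proof.
suff exk k m : m < F k -> exists2 w, size w = k & zeckendorf m w.
  have [|w _ w_n] := exk n n; last by exists w.
  elim: n => // -[|n] IHn //; rewrite FSS -addn1 leq_add //.
  by elim: n {IHn} => // -[|n] // IHn; rewrite FSS ltn_addr.
have [j] := ubnP k; elim: j k m => // j IHj [|[|k]] m lt_kj.
- by case: m => // _; exists [::]; rewrite // /zeckendorf /fibval big_ord0.
- case: m => [|[|m]] // _; [exists [:: false] | exists [:: true]] => //;
  by rewrite /zeckendorf fibval_cons /fibval big_ord0.
have [le_Fm | lt_mF] := leqP (F k.+1) m => lt_m.
  have [||w sz_w /andP[w_ok /eqP w_m]] := IHj k (m - F k.+1).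
  - by rewrite ltnS in lt_kj; apply: ltnW.
  - by rewrite ltn_subLR // -FSS.
  exists [:: true, false & w]; first by rewrite /= sz_w.
  apply/andP; split; first by case: (w) w_ok.
  by rewrite !fibval_cons /= sz_w addn0 w_m mul1n add0n subnKC.
have [||w sz_w /andP[w_ok /eqP w_m]] := IHj k.+1 m => //.
exists (false :: w); first by rewrite /= sz_w.
by apply/andP; split; [case: (w) w_ok | rewrite fibval_cons w_m].
Qed.

Lemma zeckendorf_uniq n u v : size u = size v ->
  zeckendorf n u -> zeckendorf n v -> u = v.
Proof.
move=> sz_uv /andP[u_ok /eqP <-] /andP[v_ok].
elim: u v sz_uv u_ok v_ok => [|a u IHu] [|b v] //= [sz_uv] u_ok v_ok.
have {}u_ok := path_sorted u_ok; have {}v_ok := path_sorted v_ok.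
have := fibval_lt u_ok; have := fibval_lt v_ok.
rewrite !fibval_cons sz_uv !addn0.
case: a b => [] [] /= lt_v lt_u; rewrite ?mul1n ?mul0n ?add0n ?eqn_add2l.
- by move=> uv; rewrite (IHu v).
- by move=> /eqP def_v; rewrite def_v ltnNge leq_addr in lt_v.
- by move=> /eqP def_u; rewrite -def_u ltnNge leq_addr in lt_u.
- by move=> uv; rewrite (IHu v).
Qed.

Definition phi (n : nat) : nat := fibval 1 (xchoose (zeckendorf_exists n)).

Lemma phiE n w : zeckendorf n w -> phi n = fibval 1 w.
Proof.
rewrite /phi; set u := xchoose _ => w_n.
have u_n : zeckendorf n u := xchooseP (zeckendorf_exists n).
have pad_n k x : zeckendorf n x -> zeckendorf n (nseq k false ++ x).
  by case/andP=> x_ok x_n; rewrite /zeckendorf sorted_pad // fibval_pad.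
rewrite -(fibval_pad 1 (size w)) -[RHS](fibval_pad 1 (size u)).
congr (fibval 1); apply: (zeckendorf_uniq (n := n)); try exact: pad_n.
by rewrite !size_cat !size_nseq addnC.
Qed.

Local Open Scope ring_scope.

Definition delta (m n : nat) : int :=
  (phi (m + n))%:Z - (phi m)%:Z - (phi n)%:Z.

Definition int_word (w : seq bool) : seq int := [seq (nat_of_bool b)%:Z | b <- w].

Definition pad (n : nat) (w : seq int) : seq int := nseq (n - size w) 0 ++ w.

Definition boxminus (u v : seq int) : seq int :=
  let n := maxn (size u) (size v) in
  [seq p.1 - p.2 | p <- zip (pad n u) (pad n v)].

Definition Bbar : finType := seq_sub [:: -1; 0; 1 : int].

Definition digit (b : Bbar) : int := val b.

Definition Bbar0 : Bbar := SeqSub (isT : 0 \in [:: -1; 0; 1 : int]).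

Lemma boxminus_Bbar (u v : seq bool) :
  exists w : seq Bbar, [seq digit b | b <- w] = boxminus (int_word u) (int_word v).
Proof.
rewrite /boxminus; set n := maxn _ _.
have pad_bool x : exists y, pad n (int_word x) = int_word y.
  exists (nseq (n - size (int_word x)) false ++ x).
  by rewrite /int_word map_cat map_nseq.
have [[x ->] [y ->]] := (pad_bool u, pad_bool v).
elim: x y => [|a x IHx] [|b y] /=; try by exists [::].
have [w w_xy] := IHx y.
have ab_in : (nat_of_bool a)%:Z - (nat_of_bool b)%:Z \in [:: -1; 0; 1 : int].
  by case: a; case: b.
by exists (SeqSub ab_in :: w); rewrite /= w_xy.
Qed.

Record automaton (A O : Type) := Automaton {
  state : finType;
  trans : state -> A -> state;
  init : state;
  output : state -> O
}.

(* The extension of the transition function to words, read from the left. *)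
Definition run (A O : Type) (D : automaton A O) (q : state D) (w : seq A) :
  state D := foldl (@trans A O D) q w.

(* Main.v *)
(* An expansion of m - n is guessed digit by digit, in parallel with reading
   the digits w_i of (m)_Z [-] (n)_Z.  Write c_i for the guessed digits.  The
   pair (A, B) = (sum_i (w_i - c_i) F_i, sum_i (w_i - c_i) F_{i+1}) can be
   updated without further memory, and if A = 0 at the end then the guess was
   right and B = delta(m - n, n).  For Zeckendorf words, B - alpha A stays bounded
   because the conjugate of the golden ratio alpha has modulus < 1, and in runs
   ending with A = 0 the other conjugate is bounded too; hence only finitely many
   pairs occur in successful runs, and the subset construction applies. *)
Require Import Defs.
From mathcomp Require Import all_boot all_order all_algebra.
From mathcomp Require Import realalg zify ring lra.

Set Implicit Arguments.
Unset Strict Implicit.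
Unset Printing Implicit Defensive.

Import Order.TTheory GRing.Theory Num.Theory.

Local Open Scope ring_scope.

(** * Binary words without adjacent ones and their shifted Fibonacci values *)

Notation no11 := (sorted (fun a b : bool => ~~ (a && b))).

Lemma no11_rcons c x : no11 (rcons c x) = no11 c && ~~ (last false c && x).
Proof. by case: c => //= y c; rewrite rcons_path. Qed.

Lemma fibval_rcons s w b :
  fibval s (rcons w b) = (fibval s.+1 w + b * F s)%N.
Proof.
elim: w => [|a w IHw]; first by rewrite fibval_cons /fibval !big_ord0 addnC.
by rewrite rcons_cons !fibval_cons IHw size_rcons addSnnS addnA.
Qed.

Lemma fibval_cat s u v :
  fibval s (u ++ v) = (fibval (size v + s) u + fibval s v)%N.
Proof.
elim: u => [|a u IHu]; first by rewrite /fibval big_ord0.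
by rewrite /= !fibval_cons IHu size_cat !addnA.
Qed.

Lemma fibvalSS s w : fibval s.+2 w = (fibval s.+1 w + fibval s w)%N.
Proof.
elim: w => [|a w IHw]; first by rewrite /fibval !big_ord0.
rewrite !fibval_cons IHw !addnS FSS mulnDr; lia.
Qed.

(** In [s] the values obey the Fibonacci recurrence, so shifts 0 and 1 determine all others. Hence
    the pair (A, B) is all that matters of a prefix. *)
Lemma fibvalSE s w :
  fibval s.+1 w = (fib s * fibval 0 w + fib s.+1 * fibval 1 w)%N.
Proof.
suff [] : fibval s.+1 w = (fib s * fibval 0 w + fib s.+1 * fibval 1 w)%N /\
  fibval s.+2 w = (fib s.+1 * fibval 0 w + fib s.+2 * fibval 1 w)%N by [].
elim: s => [|s [IH1 IH2]]; first by rewrite fibvalSS /=; lia.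
split=> //; rewrite fibvalSS IH2 IH1.
have -> : fib s.+3 = (fib s.+2 + fib s.+1)%N by [].
have -> : fib s.+2 = (fib s.+1 + fib s)%N by [].
lia.
Qed.

(** * Deviation of the shift from multiplication by the golden ratio *)

Definition defect (R : realFieldType) (a : R) (w : seq bool) : R :=
  (fibval 1 w)%:R - a * (fibval 0 w)%:R.

(** As F_{i+1} - a F_i = (1 - a)^(i+2), the defect is a polynomial in the conjugate 1 - a, here in
    Horner form; the last digit has weight (1 - a)^2 = 2 - a. *)
Lemma defect_rcons (R : realFieldType) (a : R) w b : a ^+ 2 = a + 1 ->
  defect a (rcons w b) = (1 - a) * defect a w + (2 - a) * b%:R.
Proof.
move=> a_sqr; rewrite /defect !fibval_rcons fibvalSS /F /= muln1 !natrD natrM.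
have -> : (1 - a) * ((fibval 1 w)%:R - a * (fibval 0 w)%:R) =
  (1 - a) * (fibval 1 w)%:R - (a - a ^+ 2) * (fibval 0 w)%:R by ring.
rewrite a_sqr; ring.
Qed.

(* The bounds are the values of the periodic expansions ...0101 and ...1010
   with the last digit prescribed. *)
Lemma defect_bounds (R : realFieldType) (a : R) w :
  a ^+ 2 = a + 1 -> 3 / 2 < a -> a < 2 -> no11 w ->
  if last false w then 2 * a - 3 <= defect a w <= a - 1
  else a - 2 <= defect a w <= 2 * a - 3.
Proof.
move=> a_sqr a_gt a_lt; elim/last_ind: w => [_|w b IHw].
  by rewrite /= /defect /fibval !big_ord0 mulr0 subr0; apply/andP; split; lra.
rewrite no11_rcons last_rcons => /andP[/IHw {}IHw].
rewrite defect_rcons //; move: (defect a w) IHw => e IHw.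
case: (last _ _) IHw => /andP[lo up]; case: b => //= _;
  apply/andP; split; nra.
Qed.

Lemma defect_in (R : realFieldType) (a : R) w :
  a ^+ 2 = a + 1 -> 3 / 2 < a -> a < 2 -> no11 w ->
  a - 2 <= defect a w <= a - 1.
Proof.
move=> a_sqr a_gt a_lt /(defect_bounds a_sqr a_gt a_lt).
by case: ifP => _ /andP[lo up]; apply/andP; split; lra.
Qed.

(** * The pair (A, B) for three words, and its bounds *)

Definition gap s (u v c : seq bool) : int :=
  (fibval s u)%:Z - (fibval s v)%:Z - (fibval s c)%:Z.

(** B - a A combines three defects lying in [a - 2, a - 1], hence lies in [-a, 3 - a]; then 1 < a <
    2 gives bounds with integer coefficients. *)
Lemma gap_bounds u v c : no11 u -> no11 v -> no11 c ->
  [/\ 0 <= gap 0 u v c -> gap 0 u v c - 2 <= gap 1 u v c <= 2 * gap 0 u v c + 2,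
      gap 0 u v c <= 0 -> 2 * gap 0 u v c - 2 <= gap 1 u v c <= gap 0 u v c + 2
    & gap 0 u v c = 0 -> -1 <= gap 1 u v c <= 1].
Proof.
move=> u_ok v_ok c_ok.
pose r : realalg := Num.sqrt 5; pose a := (1 + r) / 2.
have r_sqr : r ^+ 2 = 5 by rewrite sqr_sqrtr.
have r_ge0 : 0 <= r by rewrite sqrtr_ge0.
have r_gt : 2 < r by nra.
have r_lt : r < 3 by nra.
have a_sqr : a ^+ 2 = a + 1.
  have -> : a ^+ 2 = (1 + 2 * r + r ^+ 2) / 4 by rewrite /a; field.
  by rewrite r_sqr /a; field.
have a_gt : 3 / 2 < a by rewrite /a; lra.
have a_lt : a < 2 by rewrite /a; lra.
have /andP[u_lo u_up] := defect_in a_sqr a_gt a_lt u_ok.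
have /andP[v_lo v_up] := defect_in a_sqr a_gt a_lt v_ok.
have /andP[c_lo c_up] := defect_in a_sqr a_gt a_lt c_ok.
set A := gap 0 _ _ _; set B := gap 1 _ _ _.
have defE : defect a u - defect a v - defect a c = B%:~R - a * A%:~R.
  by rewrite /defect /A /B /gap !intrD !intrN -!pmulrn; ring.
have lo : - a <= B%:~R - a * A%:~R by lra.
have up : B%:~R - a * A%:~R <= 3 - a by lra.
move: A B {defE} lo up => A B lo up; split.
- rewrite -(ler0z realalg) => A_ge0.
  have lo_aA : A%:~R <= a * A%:~R by rewrite ler_peMl //; lra.
  have up_aA : a * A%:~R <= 2 * A%:~R by rewrite ler_wpM2r //; lra.
  by apply/andP; split; rewrite -(ler_int realalg) ?intrD ?intrM ?intrN; lra.
- rewrite -(lerz0 realalg) => A_le0.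
  have lo_aA : 2 * A%:~R <= a * A%:~R by rewrite ler_wnM2r //; lra.
  have up_aA : a * A%:~R <= A%:~R by rewrite ler_neMl //; lra.
  by apply/andP; split; rewrite -(ler_int realalg) ?intrD ?intrM ?intrN; lra.
- move=> A0; rewrite A0 mulr0 subr0 in lo up.
  have Bgt : -2 < B by rewrite -(ltr_int realalg); lra.
  have Blt : B < 2 by rewrite -(ltr_int realalg); lra.
  by clear -Bgt Blt; lia.
Qed.

Lemma fib_gt0 n : (0 < fib n.+1)%N.
Proof. by elim: n => // n IHn; rewrite /= ltn_addr. Qed.

(* With k digits left to read, a final value 0 forces A F_{k-3} + B F_{k-2} to
   be O(F_k) for the current gaps (A, B); as B - alpha A is bounded, A and B
   cannot have large opposite values, and this bounds A. *)
Lemma gap_prefix_bounds u1 v1 c1 u2 v2 c2 :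
  size u2 = size v2 -> size u2 = size c2 ->
  no11 (u1 ++ u2) -> no11 (v1 ++ v2) -> no11 (c1 ++ c2) ->
  gap 0 (u1 ++ u2) (v1 ++ v2) (c1 ++ c2) = 0 ->
  `|gap 0 u1 v1 c1| <= 12 /\ `|gap 1 u1 v1 c1| <= 12.
Proof.
move=> v_sz c_sz /cat_sorted2[u1_ok u2_ok] /cat_sorted2[v1_ok v2_ok].
move=> /cat_sorted2[c1_ok c2_ok].
have [pos neg _] := gap_bounds u1_ok v1_ok c1_ok.
have := fibval_lt u2_ok; have := fibval_lt v2_ok; have := fibval_lt c2_ok.
rewrite /gap !fibval_cat -v_sz -c_sz !addn0.
rewrite /gap in pos neg *.
case: (size u2) => [|k]; first by rewrite /F /=; lia.
rewrite !(fibvalSE k).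
have -> : F k.+1 = (fib k + 2 * fib k.+1)%N.
  rewrite /F (_ : fib k.+3 = fib k.+1 + fib k + fib k.+1)%N //; lia.
have := fib_gt0 k; move: (fib k) (fib k.+1) => f g.
move: (fibval 0 u1) (fibval 0 v1) (fibval 0 c1) pos neg => U0 V0 C0.
move: (fibval 1 u1) (fibval 1 v1) (fibval 1 c1) => U1 V1 C1.
move: (fibval 0 u2) (fibval 0 v2) (fibval 0 c2) => U V C.
set A := U0%:Z - V0%:Z - C0%:Z; set B := U1%:Z - V1%:Z - C1%:Z.
move=> pos neg g_gt0 ltC ltV ltU eq0.
have {}eq0 : f%:Z * A + g%:Z * B = V%:Z + C%:Z - U%:Z.
  by rewrite /A /B; lia.
move: A B pos neg eq0 => A B pos neg eq0.
(* If A >= 6 then B >= 4, so f A + g B >= 6 f + 4 g, whereas V + C < 2 (f + 2 g). The lower bound on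
   A is similar, using U < f + 2 g. *)
have A_le : A <= 5.
  rewrite leNgt; apply/negP => A_gt; have /andP[B_ge _] := pos ltac:(lia).
  nia.
have A_ge : -5 <= A.
  rewrite leNgt; apply/negP => A_lt; have /andP[_ B_le] := neg ltac:(lia).
  nia.
(* The constant 12 arises from |B| <= 2 |A| + 2 with |A| <= 5. *)
by have [/pos|/ltW/neg] := leP 0 A; lia.
Qed.

(** * Fibonacci values of signed-digit words *)

Fixpoint intval s (w : seq int) : int :=
  if w is d :: w' then d * (F (size w' + s))%:Z + intval s w' else 0.

Lemma intval_rcons s w d : intval s (rcons w d) = intval s.+1 w + d * (F s)%:Z.
Proof.
by elim: w => [|e w IHw] /=; rewrite ?addr0 ?add0r // IHw size_rcons addSnnS addrA.
Qed.

Lemma intvalSS s w : intval s.+2 w = intval s.+1 w + intval s w.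
Proof.
elim: w => //= d w ->; rewrite !addnS FSS PoszD; ring.
Qed.

Lemma intval_pad s k w : intval s (pad k w) = intval s w.
Proof. by rewrite /pad; elim: (k - _)%N => //= n ->; rewrite mul0r add0r. Qed.

Lemma intval_int_word s w : intval s (int_word w) = (fibval s w)%:Z.
Proof.
elim: w => [|b w IHw]; first by rewrite /fibval big_ord0.
by rewrite /= IHw size_map fibval_cons PoszD PoszM.
Qed.

Lemma intval_sub s u v : size u = size v ->
  intval s [seq p.1 - p.2 | p <- zip u v] = intval s u - intval s v.
Proof.
elim: u v => [|a u IHu] [|b v] //= [sz_uv]; rewrite IHu //.
rewrite size_map size_zip sz_uv minnn; ring.
Qed.

Lemma size_pad k w : (size w <= k)%N -> size (pad k w) = k.
Proof. by move=> le_wk; rewrite size_cat size_nseq subnK. Qed.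

Lemma intval_boxminus s u v :
  intval s (boxminus (int_word u) (int_word v)) =
  (fibval s u)%:Z - (fibval s v)%:Z.
Proof.
rewrite /boxminus intval_sub ?intval_pad ?intval_int_word //.
by rewrite !size_pad ?leq_maxl ?leq_maxr.
Qed.

(** * The subset automaton *)

Definition smallz : seq int := [seq i%:Z - 12 | i <- iota 0 25].

Lemma mem_smallz z : (z \in smallz) = (`|z| <= 12).
Proof.
apply/mapP/idP => [[i]|z_le]; first by rewrite mem_iota; lia.
exists (absz (z + 12)); rewrite ?mem_iota; lia.
Qed.

(* (A, B, x): the gaps between the word read so far and a guessed expansion
   ending with the digit x. *)
Definition guess : finType := (seq_sub smallz * seq_sub smallz * bool)%type.

Definition gap0 (q : guess) : int := val q.1.1.
Definition gap1 (q : guess) : int := val q.1.2.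

Definition guess0 : guess :=
  (SeqSub (isT : 0 \in smallz), SeqSub (isT : 0 \in smallz), false).

(** A new last digit e raises the earlier indices by one, so (A, B) becomes (B + e F_0, A + B + e
    F_1), with F_0 = 1 and F_1 = 2. *)
Definition next (d : int) (q r : guess) : bool :=
  [&& ~~ (q.2 && r.2), gap0 r == gap1 q + (d - r.2%:Z)
    & gap1 r == gap0 q + gap1 q + 2 * (d - r.2%:Z)].

Definition guess_trans (Q : {set guess}) (b : Bbar) : {set guess} :=
  [set r | [exists q in Q, next (digit b) q r]].

(* Closing under leading zeros makes the initial state a fixpoint. *)
Definition guess_init : {set guess} := [set r | connect (next 0) guess0 r].

Definition guess_output (Q : {set guess}) : Bbar :=
  if [pick r in Q | gap0 r == 0] is Some r then insubd Bbar0 (gap1 r) else Bbar0.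

Definition gap_automaton : automaton Bbar Bbar :=
  Automaton guess_trans guess_init guess_output.

Lemma guess_init_fix : guess_trans guess_init Bbar0 = guess_init.
Proof.
apply/setP=> r; rewrite !inE; apply/exists_inP/idP => [[q]|].
  by rewrite inE => q_init /connect1; apply: connect_trans.
case/connectP=> p; case/lastP: p => [_ ->|p r' p_path ->].
  (* For the empty path, [guess0] is its own successor on digit 0. *)
  by exists guess0; rewrite ?inE ?connect0.
rewrite last_rcons; move: p_path; rewrite rcons_path => /andP[p_path q_r'].
by exists (last guess0 p); rewrite // inE; apply/connectP; exists p.
Qed.

(** * Soundness: states reached come from actual guesses *)

Definition witnessed (w : seq int) (r : guess) : Prop :=
  exists c, [/\ no11 c, r.2 = last false c,
    gap0 r = intval 0 w - (fibval 0 c)%:Z & gap1 r = intval 1 w - (fibval 1 c)%:Z].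

Lemma witnessed_next w d q r :
  witnessed w q -> next d q r -> witnessed (rcons w d) r.
Proof.
case=> c [c_ok q2 q0 q1] /and3P[qr /eqP r0 /eqP r1].
exists (rcons c r.2); rewrite no11_rcons c_ok -q2 last_rcons.
rewrite !intval_rcons !fibval_rcons intvalSS fibvalSS r0 r1 q0 q1 /F /=.
split=> //; lia.
Qed.

(** Leading zeros add nothing to the word's values, but the digits guessed along them stay in [c];
    so [witnessed] leaves the length of [c] free. *)
Lemma witnessed_init r : r \in guess_init -> witnessed [::] r.
Proof.
rewrite inE => /connectP[p p_path ->].
have : witnessed [::] guess0.
  by exists [::]; split; rewrite // /fibval big_ord0.
elim: p guess0 p_path => //= q p IHp q0 /andP[q0_q p_path] q0_w.
apply: IHp => //; have [c [c_ok q2]] := witnessed_next q0_w q0_q.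
by rewrite /= !mul0r addr0 => ? ?; exists c.
Qed.

Lemma run_rcons (A O : Type) (D : automaton A O) q w b :
  run q (rcons w b) = trans (run (D := D) q w) b.
Proof. by rewrite /run -cats1 foldl_cat. Qed.

Lemma run_witnessed (w : seq Bbar) r :
  r \in run (init gap_automaton) w -> witnessed [seq digit b | b <- w] r.
Proof.
elim/last_ind: w r => [|w b IHw] r; first exact: witnessed_init.
rewrite run_rcons map_rcons inE => /exists_inP[q /IHw].
exact: witnessed_next.
Qed.

(** * Completeness: a guess whose gaps stay small is followed *)

Lemma run_complete (w : seq Bbar) c :
  size c = size w -> no11 c ->
  (forall i, (i <= size w)%N ->
    `|intval 0 (take i [seq digit b | b <- w]) - (fibval 0 (take i c))%:Z| <= 12 /\
    `|intval 1 (take i [seq digit b | b <- w]) - (fibval 1 (take i c))%:Z| <= 12) ->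
  exists r, [/\ r \in run (init gap_automaton) w, r.2 = last false c,
    gap0 r = intval 0 [seq digit b | b <- w] - (fibval 0 c)%:Z
  & gap1 r = intval 1 [seq digit b | b <- w] - (fibval 1 c)%:Z].
Proof.
elim/last_ind: w c => [|w b IHw] c.
  case: c => // _ _ _; exists guess0; rewrite inE connect0.
  by split; rewrite // /fibval big_ord0.
case/lastP: c => [|c x]; rewrite !size_rcons // => -[c_sz].
rewrite no11_rcons map_rcons => /andP[c_ok cx_ok] small.
have [|q [q_run q2 q0 q1]] := IHw c c_sz c_ok.
  move=> i le_iw; have := small i (leqW le_iw).
  by rewrite -!cats1 !takel_cat // ?size_map // c_sz.
have [] := small _ (leqnn _).
rewrite !take_oversize ?size_rcons ?size_map ?c_sz // -!mem_smallz => r0 r1.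
exists (SeqSub r0, SeqSub r1, x); split; rewrite ?last_rcons //.
rewrite run_rcons inE; apply/exists_inP; exists q => //.
rewrite /next /gap0 /gap1 /= in q0 q1 *; rewrite q2 cx_ok q0 q1.
rewrite !intval_rcons !fibval_rcons intvalSS fibvalSS /F /=.
by apply/andP; split; apply/eqP; lia.
Qed.

Lemma run_nseq0 k w :
  run (init gap_automaton) (nseq k Bbar0 ++ w) = run (init gap_automaton) w.
Proof.
by elim: k => //= k IHk; rewrite -[RHS]IHk /run /= guess_init_fix.
Qed.

Lemma zeckendorf_pad k n w : zeckendorf n w -> zeckendorf n (nseq k false ++ w).
Proof. by case/andP=> w_ok w_n; rewrite /zeckendorf sorted_pad // fibval_pad. Qed.

Lemma delta_bounds m n : -1 <= delta m n <= 1.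
Proof.
have [u u_mn] := zeckendorf_exists (m + n).
have [v v_m] := zeckendorf_exists m; have [c c_n] := zeckendorf_exists n.
rewrite /delta (phiE u_mn) (phiE v_m) (phiE c_n).
move: u_mn v_m c_n => /andP[u_ok /eqP u_mn] /andP[v_ok /eqP v_m] /andP[c_ok /eqP c_n].
have [_ _] := gap_bounds u_ok v_ok c_ok.
by rewrite /gap u_mn v_m c_n => -> //; lia.
Qed.

Lemma take_boxminus s i u v : size u = size v ->
  intval s (take i (boxminus (int_word u) (int_word v))) =
  (fibval s (take i u))%:Z - (fibval s (take i v))%:Z.
Proof.
move=> sz_uv; rewrite -!intval_int_word.
rewrite -intval_sub ?size_map ?size_take ?sz_uv //.
rewrite /boxminus /pad !size_map sz_uv maxnn subnn /= -map_take.
congr (intval _ (map _ _)).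
elim: u v i {sz_uv} => [|a u IHu] [|b v] [|i] //=; rewrite ?IHu //.
Qed.

Lemma size_boxminus u v : size (boxminus u v) = maxn (size u) (size v).
Proof. by rewrite size_map size_zip !size_pad ?leq_maxl ?leq_maxr ?minnn. Qed.

Lemma boxminus_pad k u v (n := maxn (size u) (size v)) :
  boxminus (int_word (nseq (k + (n - size u)) false ++ u))
    (int_word (nseq (k + (n - size v)) false ++ v)) =
  nseq k 0 ++ boxminus (int_word u) (int_word v).
Proof.
rewrite /boxminus /pad /int_word !size_map !size_cat !size_nseq -!addnA.
rewrite !subnK ?leq_maxl ?leq_maxr // maxnn subnn /=.
by rewrite !map_cat !map_nseq; elim: k => //= k ->.
Qed.

Lemma run_reaches_zero m n u v (w : seq Bbar) : (n <= m)%N ->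
  zeckendorf m u -> zeckendorf n v ->
  [seq digit b | b <- w] = boxminus (int_word u) (int_word v) ->
  exists2 r, r \in run (init gap_automaton) w & gap0 r = 0.
Proof.
move=> le_nm u_m v_n w_uv; have [c c_mn] := zeckendorf_exists (m - n).
(* All words are padded to the common length k + N, so that [c] can be guessed digit by digit;
   [run_nseq0] later removes the k extra zeros. *)
pose k := size c; pose N := maxn (size u) (size v).
pose U := nseq (k + (N - size u)) false ++ u.
pose V := nseq (k + (N - size v)) false ++ v.
pose C := nseq N false ++ c; pose W := nseq k Bbar0 ++ w.
have U_sz : size U = (k + N)%N by rewrite size_cat size_nseq -addnA subnK ?leq_maxl.
have V_sz : size V = (k + N)%N by rewrite size_cat size_nseq -addnA subnK ?leq_maxr.
have C_sz : size C = (k + N)%N by rewrite size_cat size_nseq addnC.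
have w_sz : size w = N by rewrite -(size_map digit) w_uv size_boxminus !size_map.
have W_sz : size W = (k + N)%N by rewrite size_cat size_nseq w_sz.
have W_UV : [seq digit b | b <- W] = boxminus (int_word U) (int_word V).
  by rewrite boxminus_pad -w_uv map_cat map_nseq.
have /andP[U_ok /eqP U_m] : zeckendorf m U by apply: zeckendorf_pad.
have /andP[V_ok /eqP V_n] : zeckendorf n V by apply: zeckendorf_pad.
have /andP[C_ok /eqP C_mn] : zeckendorf (m - n) C by apply: zeckendorf_pad.
have gap_UVC : gap 0 U V C = 0 by rewrite /gap U_m V_n C_mn; lia.
have [|//|i le_i|r [r_W _ r0 _]] := run_complete (w := W) (c := C).
- by rewrite C_sz W_sz.
- rewrite W_UV !take_boxminus ?U_sz ?V_sz //.
  apply: (@gap_prefix_bounds _ _ _ (drop i U) (drop i V) (drop i C));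
  by rewrite ?cat_take_drop ?size_drop ?U_sz ?V_sz ?C_sz.
exists r; first by rewrite -(run_nseq0 k).
by rewrite r0 W_UV intval_boxminus.
Qed.

Theorem corollary22 :
  exists D : automaton Bbar Bbar,
    trans (init D) Bbar0 = init D /\
    forall (m n : nat) (u v : seq bool) (w : seq Bbar),
      (n <= m)%N ->
      zeckendorf m u ->
      zeckendorf n v ->
      [seq digit b | b <- w] = boxminus (int_word u) (int_word v) ->
      digit (output (run (init D) w)) = delta (m - n)%N n.
Proof.
exists gap_automaton; split=> [|m n u v w le_nm u_m v_n w_uv].
  exact: guess_init_fix.
have deltaE c : zeckendorf (m - n) c ->
    delta (m - n) n = intval 1 [seq digit b | b <- w] - (fibval 1 c)%:Z.
  move=> c_mn; rewrite w_uv intval_boxminus -(phiE u_m) -(phiE v_n).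
  by rewrite -(phiE c_mn) /delta subnK // addrAC.
rewrite /= /guess_output; case: pickP => [r /andP[r_w /eqP r0]|none].
  (* Whichever state is picked, A = 0 makes its guess an expansion of m - n, so B is the required
     value. *)
  have [c [c_ok _ c0 c1]] := run_witnessed r_w.
  have c_mn : zeckendorf (m - n) c.
    rewrite /zeckendorf c_ok -eqz_nat -subzn //.
    move: c0; rewrite r0 w_uv intval_boxminus.
    by have [/andP[_ /eqP->] /andP[_ /eqP->]] := (u_m, v_n); lia.
  (* [insubd] does not fall back on its default, since delta lies in {-1, 0, 1}. *)
  rewrite /digit c1 -(deltaE c c_mn) insubdK //.
  have := delta_bounds (m - n) n; move: (delta _ _) => d.
  by rewrite !inE; lia.
(* Completeness rules out the default branch. *)
have [r r_w r0] := run_reaches_zero le_nm u_m v_n w_uv.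
by have := none r; rewrite /= r_w r0.
Qed.
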